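(* Let $X\subset\mathbb{R}^n$ be a nonempty orthosymmetric convex set and $\gamma$ an orthosymmetric norm on $\mathbb{R}^n$. Then for every $k\ge1$, $$\mathfrak{M}^{\mathsf S}_k(X,\gamma)\ \ge\ \frac{1}{8\sqrt{k\log3}}\ \sup_{x\in X}\gamma^*(x).$$
   Context: A set $X$ is orthosymmetric if $x\in X$ and $\sigma\in\{\pm1\}^n$ imply $(\sigma_jx_j)_j\in X$; a norm $\gamma$ is orthosymmetric if $\gamma((\sigma_jv_j)_j)=\gamma(v)$ for all $\sigma\in\{\pm1\}^n$. $\gamma^*(z)=\sup_{\gamma(x)\le1}x^\top z$ is the dual norm. For a measurable sample space $\mathcal{S}$, $\mathcal{F}^{\gamma,1}$ denotes the functions $F:\mathbb{R}^n\times\mathcal{S}\to\mathbb{R}$, convex in the first argument and measurable in the second, such that $\gamma(g)\le1$ for all $x\in\mathbb{R}^n$, $s\in\mathcal{S}$, $g\in\partial_xF(x,s)$. For a distribution $P$ on $\mathcal{S}$ with $F(x,\cdot)$ $P$-integrable for all $x$, $f_P(x)=\int F(x,s)\,dP(s)$. The minimax stochastic risk is $$\mathfrak{M}^{\mathsf S}_k(X,\gamma)=\sup_{\mathcal{S}}\inf_{\hat x_k}\sup_{F\in\mathcal{F}^{\gamma,1}}\sup_{P}\ \mathbb{E}\Big[f_P(\hat x_k)-\inf_{x\in X}f_P(x)\Big],$$ where $\hat x_k$ is any $\mathbb{R}^n$-valued rule (values may lie outside $X$) based on the observed functions $F(\cdot,S_1),\dots,F(\cdot,S_k)$, $S_i$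 i.i.d. from $P$ (measurable in the samples for each $F$). *)

(* Defs.v *)
From HB Require Import structures.
From mathcomp Require Import all_boot all_order all_algebra.
From mathcomp Require Import all_classical all_reals all_analysis.

Set Implicit Arguments.
Unset Strict Implicit.
Unset Printing Implicit Defensive.

Import Order.TTheory GRing.Theory Num.Theory.
Import numFieldNormedType.Exports.

Local Open Scope classical_set_scope.
Local Open Scope ring_scope.

(* R is an arbitrary realType and the vectors of
   R^n are the row vectors of type 'rV[R]_n. *)

Section Geometry.
Context {R : realType} {n : nat}.
Implicit Types (x y g v z : 'rV[R]_n) (X : set 'rV[R]_n) (gamma : 'rV[R]_n -> R).

Definition dot x y : R := \sum_(j < n) x ord0 j * y ord0 j.

(* {-1, 1}^n is encoded by the functions sigma : 'I_n -> bool, the sign of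
   coordinate j being (-1) ^+ sigma j. *)
Definition flip (sigma : 'I_n -> bool) x : 'rV[R]_n :=
  \row_j ((-1) ^+ sigma j * x ord0 j).

Definition orthosymmetric_set X : Prop :=
  forall x (sigma : 'I_n -> bool), X x -> X (flip sigma x).

Definition is_norm gamma : Prop :=
  [/\ forall x y, gamma (x + y) <= gamma x + gamma y,
      forall (a : R) x, gamma (a *: x) = `|a| * gamma x
    & forall x, gamma x = 0 -> x = 0].

Definition orthosymmetric_norm gamma : Prop :=
  forall v (sigma : 'I_n -> bool), gamma (flip sigma v) = gamma v.

Definition dual_norm gamma z : \bar R :=
  ereal_sup [set (dot x z)%:E | x in [set x | gamma x <= 1]].

Definition subdifferential (f : 'rV[R]_n -> R) x : set 'rV[R]_n :=
  [set g | forall y, f x + dot g (y - x) <= f y].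

End Geometry.

Section ProductLaw.
Context {d : measure_display} {S : measurableType d} {R : realType}.

Definition tcons k (p : S * k.-tuple S) : k.+1.-tuple S := [tuple of p.1 :: p.2].

Lemma measurable_tcons k : measurable_fun [set: S * k.-tuple S] (@tcons k).
Proof. exact: measurable_cons. Qed.

HB.instance Definition _ k :=
  isMeasurableFun.Build _ _ _ _ (@tcons k) (@measurable_tcons k).

(* The law of k i.i.d. draws from P: the k-fold product measure. *)
Fixpoint iid_law (P : probability S R) k : probability (k.-tuple S) R :=
  match k return probability (k.-tuple S) R with
  | 0 => \d_ ([tuple] : 0.-tuple S)
  | k'.+1 => distribution (P \x iid_law P k')%E (@tcons k')
  end.

Lemma iid_law_rect (P : probability S R) k
    (A : 'I_k -> set S) (mA : forall i, measurable (A i)) :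
  iid_law P k [set t | forall i, A i (tnth t i)] = (\prod_(i < k) P (A i))%E.
Proof.
elim: k A mA => [|k IH] A mA.
  rewrite big_ord0 /= diracE mem_set//; by case.
rewrite big_ord_recl /= /pushforward.
rewrite (_ : _ @^-1` _ = A ord0 `*` [set t | forall i, A (lift ord0 i) (tnth t i)]); last first.
  apply/seteqP; split => -[x t] /=.
    move=> h; split; first by have := h ord0; rewrite /tcons tnth0.
    by move=> i; have := h (lift ord0 i); rewrite /tcons tnthS.
  move=> [h0 h] i; case: (unliftP ord0 i) => [j ->|->]; rewrite /tcons.
    by rewrite tnthS; exact: h.
  by rewrite tnth0.
rewrite product_measure1E//.
  by congr (_ * _)%E; exact: (IH (fun i => A (lift ord0 i))).
rewrite [X in measurable X](_ : _ = \bigcap_(i in [set: 'I_k])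
    ((fun t : k.-tuple S => tnth t i) @^-1` A (lift ord0 i))).
  apply: fin_bigcap_measurable; first exact: finite_finset.
  by move=> i _; rewrite -[X in measurable X]setTI; exact: measurable_tnth.
by apply/seteqP; split => [t h i _|t h i]; [exact: h|exact: (h i I)].
Qed.

End ProductLaw.

Section Minimax.
Context {R : realType} {n : nat}.
Implicit Types (X : set 'rV[R]_n) (gamma : 'rV[R]_n -> R).

Definition fun_class gamma d (S : measurableType d) :
    set ('rV[R]_n -> S -> R) :=
  [set F | [/\ forall s, convex_function [set: convex_lmodType 'rV[R]_n] (F ^~ s),
               forall x, measurable_fun [set: S] (F x)
             & forall x s g, subdifferential (F ^~ s) x g -> gamma g <= 1]].

Definition admissible_law d (S : measurableType d) (F : 'rV[R]_n -> S -> R) :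
    set (probability S R) :=
  [set P | forall x, P.-integrable [set: S] (fun s => (F x s)%:E)].

(* f_P; finite for P in admissible_law F. *)
Definition objective d (S : measurableType d) (F : 'rV[R]_n -> S -> R)
    (P : probability S R) (x : 'rV[R]_n) : \bar R :=
  (\int[P]_s (F x s)%:E)%E.

Definition observe k d (S : measurableType d) (F : 'rV[R]_n -> S -> R)
    (t : k.-tuple S) : k.-tuple ('rV[R]_n -> R) :=
  [tuple F ^~ (tnth t i) | i < k].

(* Borel measurability into R^n is measurability of all the coordinates. *)
Definition decision_rule gamma k d (S : measurableType d) :
    set (k.-tuple ('rV[R]_n -> R) -> 'rV[R]_n) :=
  [set xhat | forall F : 'rV[R]_n -> S -> R, fun_class gamma F ->
     forall j : 'I_n,
       measurable_fun [set: k.-tuple S] (fun t => xhat (observe F t) ord0 j)].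

(* If the positive and the negative part of the excess risk both have infinite
   expectation, the library integral is -oo: such a rule is credited with the
   smallest possible risk. *)
Definition risk X k d (S : measurableType d)
    (xhat : k.-tuple ('rV[R]_n -> R) -> 'rV[R]_n)
    (F : 'rV[R]_n -> S -> R) (P : probability S R) : \bar R :=
  (\int[iid_law P k]_t
     (objective F P (xhat (observe F t))
      - ereal_inf [set objective F P x | x in X]))%E.

Definition minimax_risk_on X gamma k d (S : measurableType d) : \bar R :=
  ereal_inf
    [set ereal_sup
       [set ereal_sup [set risk X xhat F P | P in admissible_law F]
       | F in @fun_class gamma d S]
    | xhat in decision_rule gamma (k:=k) S].

Definition minimax_risk X gamma k : \bar R :=
  ereal_sup [set r | exists (d : measure_display) (S : measurableType d),
                       r = minimax_risk_on X gamma k S].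

End Minimax.

(* Main.v *)
Require Import Defs.
From mathcomp Require Import all_boot all_order all_algebra.
From mathcomp Require Import all_classical all_reals all_analysis.
From mathcomp Require Import measurable_realfun.
From mathcomp Require Import ring lra.

Import Order.TTheory GRing.Theory Num.Theory.
Import numFieldNormedType.Exports.

Local Open Scope classical_set_scope.
Local Open Scope ring_scope.

(** The proof is a two-point (Le Cam) argument on the sample space bool.

    Fix x in X and z with gamma z <= 1, and let r and w be the vectors of the
    absolute values of their coordinates.  Both r and - r lie in X, gamma w <= 1,
    and the pairing of w and r dominates that of z and x; so it is enough to bound
    the risk below by a multiple of D := dot w r.  Take the loss

      F(x, s) = sum_j w_j |x_j - (-1)^s r_j|,

    whose subgradients are dominated coordinatewise by w, hence have gamma at most
    gamma w because an orthosymmetric norm is monotone in the absolute values of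
    the coordinates ([orthosymmetric_norm_mono], [signed_distance_fun_class]).
    Let the sample bit be s = b with probability (1 + delta) / 2.  Since
    F(x, 0) + F(x, 1) >= 2 D, the expected loss under the law b is minimized over
    the whole of R^n at the point (-1)^b r of X, with value (1 - delta) D.  Its
    excess over this value is therefore nonnegative even at points outside X, so
    that a rule gains nothing by leaving X, and the two excesses of any point
    add up to at least 2 delta D ([excess_ge0], [excess_sum]): no decision is good
    under both laws.  One sign common to all the coordinates is enough for this,
    and two laws replace the usual 2^n.

    The samples hardly tell the two laws apart: the product of the probabilities
    of an outcome t under the two k-fold laws is ((1 - delta^2) / 4)^k, the same
    for all t.  If (1 - delta^2)^k >= 9/16, an elementary inequality yields that
    the minimum of the two probabilities has total mass at least 1/3, so the two
    risks add up to at least (2/3) delta D ([two_point_average],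
    [two_point_risk]).  The choice delta = 1 / (2 sqrt (k ln 3)) fulfils this
    condition, by the Bernoulli inequality and ln 3 >= 2/3 ([two_point_bias]);
    then max risk >= delta D / 3 >= delta D / 4 = D / (8 sqrt (k ln 3)). *)

(** * Monotonicity of orthosymmetric norms *)

Section OrthosymmetricNorm.
Context {R : realType} {n : nat} (gamma : 'rV[R]_n -> R).
Context (gamma_norm : is_norm gamma).
Context (gamma_orthosymmetric : orthosymmetric_norm gamma).

(** When u and v differ in coordinate i only, u lies on the segment between v and
    the reflection of v in that coordinate, two vectors of the same norm. *)
Lemma orthosymmetric_norm_coord (u v : 'rV[R]_n) (i : 'I_n) :
  (forall j, j != i -> u ord0 j = v ord0 j) ->
  `|u ord0 i| <= v ord0 i -> gamma u <= gamma v.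
Proof.
move=> uv uvi; case: gamma_norm => gammaD gammaZ _.
have [vi0|vi_neq0] := eqVneq (v ord0 i) 0.
  suff -> : u = v by [].
  apply/rowP => j; have [->|/uv//] := eqVneq j i.
  by apply/eqP; rewrite vi0 -normr_le0 -vi0.
have vi_gt0 : 0 < v ord0 i by rewrite lt_def vi_neq0 (le_trans _ uvi).
(* The weight with t v_i + (1 - t) (- v_i) = u_i. *)
pose t := (1 + u ord0 i / v ord0 i) / 2.
have ratio_le1 : `|u ord0 i / v ord0 i| <= 1.
  by rewrite normrM normfV (gtr0_norm vi_gt0) ler_pdivrMr// mul1r.
have t01 : 0 <= t <= 1 by move: ratio_le1; rewrite ler_norml /t; lra.
pose sigma j := j == i.
have -> : u = t *: v + (1 - t) *: flip sigma v.
  apply/rowP => j; rewrite !mxE /sigma.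
  have [->|/uv->] := eqVneq j i; last by rewrite expr0; ring.
  by rewrite expr1 /t; field.
apply: (le_trans (gammaD _ _)); rewrite !gammaZ gamma_orthosymmetric.
by rewrite !ger0_norm; lra.
Qed.

(** The coordinates of u are replaced by those of v one at a time. *)
Lemma orthosymmetric_norm_mono (u v : 'rV[R]_n) :
  (forall j, `|u ord0 j| <= v ord0 j) -> gamma u <= gamma v.
Proof.
move=> uv.
pose mix m : 'rV[R]_n := \row_j (if (j < m)%N then v ord0 j else u ord0 j).
suff mix_le m : (m <= n)%N -> gamma u <= gamma (mix m).
  have -> : v = mix n by apply/rowP => j; rewrite mxE ltn_ord.
  exact: mix_le.
elim: m => [_|m IH m_lt_n].
  by have -> : mix 0%N = u by apply/rowP => j; rewrite mxE.
apply: (le_trans (IH (ltnW m_lt_n))).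
apply: (@orthosymmetric_norm_coord _ _ (Ordinal m_lt_n)) => [j j_neq|].
  have /negbTE val_j_neq : (j != m :> nat) := j_neq.
  by rewrite !mxE ltnS (leq_eqVlt j) val_j_neq.
by rewrite !mxE ltnn ltnSn.
Qed.

End OrthosymmetricNorm.

(** * The loss function *)

Section WeightedDistance.
Context {R : realType} {n : nat} (w r : 'rV[R]_n).
Context (w_ge0 : forall j, 0 <= w ord0 j).

Definition signed_distance (x : 'rV[R]_n) (s : bool) : R :=
  \sum_(j < n) w ord0 j * `|x ord0 j - (-1) ^+ s * r ord0 j|.

Lemma signed_distance_ge0 x s : 0 <= signed_distance x s.
Proof. by apply: sumr_ge0 => j _; rewrite mulr_ge0. Qed.

(** The triangle inequality between r and - r: no point is close to both. *)
Lemma signed_distance_sum x :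
  2 * dot w r <= signed_distance x true + signed_distance x false.
Proof.
rewrite /dot /signed_distance mulr_sumr -big_split; apply: ler_sum => j _ /=.
rewrite -mulrDr mulrCA ler_wpM2l// expr0 expr1.
rewrite (le_trans (ler_norm _))// (le_trans _ (ler_normB _ _))//.
by rewrite le_eqVlt; apply/orP; left; apply/eqP; congr `|_|; ring.
Qed.

Lemma signed_distance_center s :
  (forall j, 0 <= r ord0 j) ->
  forall s', signed_distance (flip (fun=> s) r) s' = (s != s')%:R * (2 * dot w r).
Proof.
move=> r_ge0 s'; rewrite /signed_distance /dot !mulr_sumr; apply: eq_bigr => j _.
rewrite mxE; case: s s' => -[] /=; rewrite ?expr0 ?expr1.
- by rewrite subrr normr0; ring.
- by rewrite -normrN ger0_norm; [ring|have := r_ge0 j; lra].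
- by rewrite ger0_norm; [ring|have := r_ge0 j; lra].
- by rewrite subrr normr0; ring.
Qed.

Lemma signed_distance_convex s :
  convex_function [set: convex_lmodType 'rV[R]_n] (signed_distance ^~ s).
Proof.
move=> t x y _ _; pose c : R := t%:num.
have c_ge0 : 0 <= c by rewrite /c.
have c_le1 : c <= 1 by rewrite /c.
change (signed_distance (c *: (x : 'rV[R]_n) + (1 - c) *: (y : 'rV[R]_n)) s <=
        c * signed_distance x s + (1 - c) * signed_distance y s).
rewrite /signed_distance !mulr_sumr -big_split; apply: ler_sum => j _ /=.
rewrite !mxE (mulrCA c) (mulrCA (1 - c)) -mulrDr ler_wpM2l//.
set a := (-1) ^+ s * _.
have -> : c * x ord0 j + (1 - c) * y ord0 j - a =
    c * (x ord0 j - a) + (1 - c) * (y ord0 j - a) by ring.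
have c1_ge0 : 0 <= 1 - c by rewrite subr_ge0.
rewrite (le_trans (ler_normD _ _))// !normrM.
by rewrite (ger0_norm c_ge0) (ger0_norm c1_ge0).
Qed.

(** Testing the subgradient inequality along the coordinate directions: the loss is
    Lipschitz in coordinate j with constant w_j. *)
Lemma signed_distance_subdifferential s x g :
  subdifferential (signed_distance ^~ s) x g ->
  forall j, `|g ord0 j| <= w ord0 j.
Proof.
move=> sub_g j.
have sub_j (c : R) : c * g ord0 j <= w ord0 j * `|c|.
  have := sub_g (x + c *: delta_mx ord0 j); rewrite addrAC subrr add0r.
  rewrite [dot _ _](bigD1 j)//= big1 ?addr0; last first.
    by move=> i /negbTE i_neq; rewrite !mxE i_neq andbF mulr0 mulr0.
  rewrite !mxE !eqxx mulr1 /signed_distance (bigD1 j)//= [leRHS](bigD1 j)//=.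
  have -> : \sum_(i < n | i != j) w ord0 i *
      `|(x + c *: delta_mx ord0 j) ord0 i - (-1) ^+ s * r ord0 i| =
    \sum_(i < n | i != j) w ord0 i * `|x ord0 i - (-1) ^+ s * r ord0 i|.
    apply: eq_bigr => i /negbTE i_neq.
    by rewrite !mxE i_neq andbF mulr0 addr0.
  rewrite !mxE !eqxx mulr1; set a := (-1) ^+ s * _.
  have : w ord0 j * `|x ord0 j + c - a| <= w ord0 j * (`|x ord0 j - a| + `|c|).
    by rewrite ler_wpM2l// addrAC ler_normD.
  by rewrite mulrDr (mulrC (g ord0 j)); lra.
by have := sub_j 1; have := sub_j (-1); rewrite ler_norml normrN normr1; lra.
Qed.

Lemma signed_distance_fun_class (gamma : 'rV[R]_n -> R) :
  is_norm gamma -> orthosymmetric_norm gamma -> gamma w <= 1 ->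
  fun_class gamma signed_distance.
Proof.
move=> gamma_norm gamma_ortho gamma_w; split => [s|x|x s g sub_g].
- exact: signed_distance_convex.
- by move=> _ B _.
- apply: le_trans gamma_w; apply: orthosymmetric_norm_mono => // j.
  exact: signed_distance_subdifferential sub_g j.
Qed.

End WeightedDistance.

(** * Integration against the law of k random bits *)

Section TupleBool.
Context {R : realType} {k : nat}.
Implicit Types (A : set (k.-tuple bool)) (P : probability bool R).

Lemma tuple_bool_measurable A : measurable A.
Proof.
have -> : A = \bigcup_(a in A) [set a] by rewrite bigcup_imset1 image_id.
apply: fin_bigcup_measurable => [|a _]; first exact: finite_finset.
rewrite [X in measurable X](_ : _ = \bigcap_(i in [set: 'I_k])
    ((fun t : k.-tuple bool => tnth t i) @^-1` [set tnth a i])).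
  apply: fin_bigcap_measurable; first exact: finite_finset.
  by move=> i _; rewrite -[X in measurable X]setTI; exact: measurable_tnth.
by apply/seteqP; split => [_ -> //|t ta]; apply: eq_from_tnth => i; exact: ta.
Qed.

Lemma tuple_bool_measurable_fun (f : k.-tuple bool -> \bar R) :
  measurable_fun [set: k.-tuple bool] f.
Proof. by move=> _ B _; exact: tuple_bool_measurable. Qed.

Lemma iid_law_set1 P (p : bool -> R) (a : k.-tuple bool) :
  (forall s, P [set s] = (p s)%:E) ->
  iid_law P k [set a] = (\prod_(i < k) p (tnth a i))%:E.
Proof.
move=> Pp.
have -> : [set a] = [set t | forall i, [set tnth a i] (tnth t i)].
  by apply/seteqP; split => [_ -> //|t ta]; apply: eq_from_tnth => i; exact: ta.
rewrite (iid_law_rect P (A := fun i => [set tnth a i]))//.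
by rewrite -prodEFin; apply: eq_bigr => i _; rewrite Pp.
Qed.

Lemma ge0_integral_iid_law P (p : bool -> R) (e : k.-tuple bool -> R) :
  (forall s, P [set s] = (p s)%:E) -> (forall t, 0 <= e t) ->
  (\int[iid_law P k]_t (e t)%:E =
   (\sum_t (\prod_(i < k) p (tnth t i)) * e t)%:E)%E.
Proof.
move=> Pp e_ge0.
transitivity (\int[iid_law P k]_t
    \sum_(a : k.-tuple bool) ((e a)%:E * (\1_[set a] t)%:E))%E.
  apply: eq_integral => t _; rewrite (bigD1 t)//= big1 ?adde0.
    by rewrite indicE mem_set// mule1.
  by move=> a a_neq; rewrite indicE memNset ?mule0// => /esym/eqP;
    rewrite (negbTE a_neq).
rewrite ge0_integral_sum//; last 2 first.
- by move=> a; exact: tuple_bool_measurable_fun.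
- by move=> a t _; rewrite mule_ge0// lee_fin.
rewrite -sumEFin; apply: eq_bigr => a _.
rewrite ge0_integralZl//; last 2 first.
- exact: tuple_bool_measurable_fun.
- exact: e_ge0.
rewrite integral_indic//; last exact: tuple_bool_measurable.
by rewrite setIT muleC EFinM; congr (_ * _)%E; exact: iid_law_set1.
Qed.

End TupleBool.


(** * Two laws that are hard to tell apart *)

(** Le Cam's argument.  At each t, the weighted sum p0 e0 + p1 e1 is at least
    min (p0, p1) (e0 + e1) >= c min (p0, p1), so it is enough that the total mass of
    min (p0, p1) is at least 1/3.  Write m for the uniform mass 1 / #|T| and a <= b for the two
    masses at t; since a b >= (3 m / 4)^2, the inequality of arithmetic and geometric
    means gives 4 a + b >= 2 sqrt (4 a b) >= 3 m, that is, 3 a >= 3 m - (a + b),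
    which sums to 3 - 2 = 1. *)
Lemma two_point_average {R : realType} {T : finType} (p0 p1 e0 e1 : T -> R) (c : R) :
  (forall t, 0 <= p0 t) -> (forall t, 0 <= p1 t) ->
  \sum_t p0 t = 1 -> \sum_t p1 t = 1 ->
  (forall t, 9 / 16 <= #|T|%:R ^+ 2 * (p0 t * p1 t)) ->
  (forall t, 0 <= e0 t) -> (forall t, 0 <= e1 t) ->
  0 <= c -> (forall t, c <= e0 t + e1 t) ->
  c / 3 <= \sum_t p0 t * e0 t + \sum_t p1 t * e1 t.
Proof.
move=> p0_ge0 p1_ge0 p0_sum p1_sum p01 e0_ge0 e1_ge0 c_ge0 e01.
have T_gt0 : (0 < #|T|)%N.
  rewrite lt0n; apply/eqP => T0; move/eqP: p0_sum; rewrite big1 => [|t _].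
    by rewrite eq_sym oner_eq0.
  by have := card0_eq T0 t; rewrite inE.
have N_gt0 : 0 < #|T|%:R :> R by rewrite ltr0n.
pose m : R := #|T|%:R^-1.
have m_gt0 : 0 < m by rewrite invr_gt0.
have tangent a b : 0 <= a -> 0 <= b -> 9 / 16 <= #|T|%:R ^+ 2 * (a * b) ->
    3 * m <= 4 * a + b.
  move=> a_ge0 b_ge0 ab.
  have {}ab : 9 / 16 * m ^+ 2 <= a * b.
    by rewrite -ler_pdivlMr ?exprn_gt0// /m -exprVn invrK [leRHS]mulrC.
  have m3_ge0 : 0 <= 3 * m by lra.
  have ab4_ge0 : 0 <= 4 * a + b by lra.
  rewrite -(@ler_pXn2r _ 2)//.
  have : 0 <= (4 * a - b) ^+ 2 by rewrite sqr_ge0.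
  by lra.
have pointwise t : (3 * m - (p0 t + p1 t)) * c <= 3 * (p0 t * e0 t + p1 t * e1 t).
  have h0 := tangent _ _ (p0_ge0 t) (p1_ge0 t) (p01 t).
  have h1 : 3 * m <= 4 * p1 t + p0 t.
    by apply: tangent => //; rewrite (mulrC (p1 t)).
  have := p0_ge0 t; have := p1_ge0 t; have := e0_ge0 t; have := e1_ge0 t.
  have := e01 t; move: h0 h1.
  move: (p0 t) (p1 t) (e0 t) (e1 t) => a b x y h0 h1 cxy y0 x0 b0 a0.
  case: (leP a b) => ab.
    have : 0 <= (4 * a + b - 3 * m) * c by rewrite mulr_ge0// subr_ge0.
    have : 0 <= a * (x + y - c) by rewrite mulr_ge0// subr_ge0.
    have : 0 <= (b - a) * y by rewrite mulr_ge0// subr_ge0.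
    by lra.
  have : 0 <= (4 * b + a - 3 * m) * c by rewrite mulr_ge0// subr_ge0.
  have : 0 <= b * (x + y - c) by rewrite mulr_ge0// subr_ge0.
  have : 0 <= (a - b) * x by rewrite mulr_ge0// subr_ge0 ltW.
  by lra.
have sum_m : \sum_(t : T) m = 1.
  by rewrite sumr_const cardT -cardE -[LHS]mulr_natr mulVf// gt_eqF.
rewrite ler_pdivrMr// mulrC -big_split mulr_sumr /=.
apply: le_trans (ler_sum _ (fun t _ => pointwise t)).
by rewrite -mulr_suml sumrB -mulr_sumr big_split /= sum_m p0_sum p1_sum; lra.
Qed.

(** * The biased coins *)

Lemma bernoulli_inequality {R : realFieldType} (d : R) (k : nat) :
  0 <= d <= 1 -> 1 - k%:R * d <= (1 - d) ^+ k.
Proof.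
case/andP=> d_ge0 d_le1; elim: k => [|k IH]; first by rewrite mul0r subr0 expr0.
rewrite exprS -natr1.
have : 0 <= (1 - d) * ((1 - d) ^+ k - (1 - k%:R * d)).
  by rewrite mulr_ge0// subr_ge0.
have : 0 <= k%:R * d ^+ 2 by rewrite mulr_ge0// sqr_ge0.
by lra.
Qed.

Section Coin.
Context {R : realType} (delta : R).

Definition coin (b s : bool) : R := (1 + (-1) ^+ (b (+) s) * delta) / 2.

Context (delta01 : 0 <= delta <= 1).

Lemma coin_ge0 b s : 0 <= coin b s.
Proof.
by case/andP: delta01; rewrite /coin; case: (b (+) s); rewrite ?expr0 ?expr1; lra.
Qed.

Lemma coin_true01 b : 0 <= coin b true <= 1.
Proof.
by case/andP: delta01; rewrite /coin; case: b; rewrite ?expr0 ?expr1; lra.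
Qed.

Lemma coin_false b : 1 - coin b true = coin b false.
Proof. by rewrite /coin; case: b; rewrite ?expr0 ?expr1; field. Qed.

Definition coin_law b : probability bool R := bernoulli_prob (coin b true).

Lemma coin_law_set1 b s : coin_law b [set s] = (coin b s)%:E.
Proof.
rewrite /coin_law /= bernoulli_probE ?coin_true01// !diracE /=.
change (unstable.onem (coin b true)) with (1 - coin b true).
have mem x : (x \in [set s]) = (x == s) by apply/idP/eqP; rewrite inE.
by rewrite coin_false !mem; case: s {mem}; rewrite /= mule1 mule0 ?adde0 ?add0e.
Qed.

Lemma integral_coin_law b (f : bool -> R) : (forall s, 0 <= f s) ->
  (\int[coin_law b]_s (f s)%:E = (coin b true * f true + coin b false * f false)%:E)%E.
Proof.
move=> f_ge0; rewrite integral_bernoulli_prob ?coin_true01//.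
by rewrite -coin_false.
Qed.

(** A bit has probabilities (1 + delta) / 2 and (1 - delta) / 2 under the two coins,
    in an order that depends on the bit; hence the product does not see t. *)
Lemma coin_product k (t : k.-tuple bool) :
  (\prod_(i < k) coin true (tnth t i)) * (\prod_(i < k) coin false (tnth t i)) =
  ((1 - delta ^+ 2) / 4) ^+ k.
Proof.
rewrite -big_split /= (eq_bigr (fun=> (1 - delta ^+ 2) / 4)).
  by rewrite prodr_const card_ord.
by move=> i _; rewrite /coin; case: (tnth t i); rewrite ?expr0 ?expr1; field.
Qed.

Lemma coin_law_sum k b : \sum_(t : k.-tuple bool) \prod_(i < k) coin b (tnth t i) = 1.
Proof.
have := ge0_integral_iid_law (coin_law b) (coin b) (fun=> 1)
  (coin_law_set1 b) (fun _ : k.-tuple bool => ler01).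
rewrite integral_cst// [X in (_ * X)%E](_ : _ = 1%E) => [|]; last first.
  exact: probability_setT.
rewrite mule1 => -[] /esym.
by under eq_bigr do rewrite mulr1.
Qed.

End Coin.

(** * The risk under the two laws *)

Section TwoPointLowerBound.
Context {R : realType} {n : nat} (X : set 'rV[R]_n) (w r : 'rV[R]_n) (delta : R).
Context (w_ge0 : forall j, 0 <= w ord0 j) (r_ge0 : forall j, 0 <= r ord0 j).
Context (X_center : forall b, X (flip (fun=> b) r)).
Context (delta01 : 0 <= delta <= 1).

(** The value (1 - delta) D that is subtracted is the minimum of the expected loss:
    see [inf_objective_coin_law]. *)
Definition excess (b : bool) (x : 'rV[R]_n) : R :=
  coin delta b true * signed_distance w r x true
  + coin delta b false * signed_distance w r x false - (1 - delta) * dot w r.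

Lemma dot_ge0 : 0 <= dot w r.
Proof. by apply: sumr_ge0 => j _; rewrite mulr_ge0. Qed.

(** With l0, l1 the losses at the two bits, the excess under the law b is
    (1 - delta) / 2 (l0 + l1 - 2 D) + delta l_b. *)
Lemma excess_ge0 b x : 0 <= excess b x.
Proof.
case/andP: delta01 => delta_ge0 delta_le1.
have sum_ge := signed_distance_sum w r w_ge0 x.
have := signed_distance_ge0 w r w_ge0 x true.
have := signed_distance_ge0 w r w_ge0 x false.
rewrite /excess /coin; move: sum_ge.
move: (signed_distance w r x true) (signed_distance w r x false) => l1 l0.
move=> sum_ge l0_ge0 l1_ge0.
have : 0 <= (1 - delta) * (l1 + l0 - 2 * dot w r) by rewrite mulr_ge0// subr_ge0.
have := mulr_ge0 delta_ge0 l0_ge0; have := mulr_ge0 delta_ge0 l1_ge0.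
by case: b; rewrite /= ?expr0 ?expr1; lra.
Qed.

Lemma excess_sum x : 2 * delta * dot w r <= excess true x + excess false x.
Proof.
have := signed_distance_sum w r w_ge0 x.
by rewrite /excess /coin /= ?expr0 ?expr1; lra.
Qed.

Lemma objective_coin_law b x :
  objective (signed_distance w r) (coin_law delta b) x =
  (excess b x + (1 - delta) * dot w r)%:E.
Proof.
rewrite /objective integral_coin_law// => [|s]; last exact: signed_distance_ge0.
by rewrite /excess subrK.
Qed.

Lemma admissible_coin_law b :
  admissible_law (signed_distance w r) (coin_law delta b).
Proof.
move=> x; apply/integrableP; split; first by move=> _ B _.
rewrite (_ : (\int[_]_s _)%E = objective (signed_distance w r) (coin_law delta b) x).
  by rewrite objective_coin_law ltry.
apply: eq_integral => s _.
by rewrite abse_EFin ger0_norm// signed_distance_ge0.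
Qed.

(** The infimum is attained at (-1)^b r, where the loss is 0 at the likely bit and
    2 D at the other one. *)
Lemma inf_objective_coin_law b :
  (ereal_inf [set objective (signed_distance w r) (coin_law delta b) x | x in X] =
   ((1 - delta) * dot w r)%:E)%E.
Proof.
apply/eqP; rewrite eq_le; apply/andP; split.
  apply: ereal_inf_lbound; exists (flip (fun=> b) r) => //.
  rewrite objective_coin_law /excess subrK !signed_distance_center// /coin.
  by congr EFin; case: b; rewrite /= ?expr0 ?expr1; field.
apply: le_ereal_inf_tmp => _ [x _ <-].
by rewrite objective_coin_law lee_fin lerDr excess_ge0.
Qed.

(** The integrand of the risk is the nonnegative excess, so that the risk is a
    finite sum and the convention for undefined integrals is never triggered. *)
Lemma risk_coin_law k b (xhat : k.-tuple ('rV[R]_n -> R) -> 'rV[R]_n) :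
  risk X xhat (signed_distance w r) (coin_law delta b) =
  (\sum_(t : k.-tuple bool) (\prod_(i < k) coin delta b (tnth t i))
     * excess b (xhat (observe (signed_distance w r) t)))%:E.
Proof.
rewrite -(ge0_integral_iid_law (coin_law delta b)); last 2 first.
- exact: coin_law_set1.
- by move=> t; exact: excess_ge0.
apply: eq_integral => t _.
by rewrite inf_objective_coin_law objective_coin_law -EFinB addrK.
Qed.

Lemma two_point_risk k (xhat : k.-tuple ('rV[R]_n -> R) -> 'rV[R]_n) :
  9 / 16 <= (1 - delta ^+ 2) ^+ k ->
  exists b, ((delta * dot w r / 3)%:E <=
    risk X xhat (signed_distance w r) (coin_law delta b))%E.
Proof.
move=> overlap.
pose p b (t : k.-tuple bool) := \prod_(i < k) coin delta b (tnth t i).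
pose e b (t : k.-tuple bool) := excess b (xhat (observe (signed_distance w r) t)).
have p_ge0 b t : 0 <= p b t by apply: prodr_ge0 => i _; exact: coin_ge0.
have avg : 2 * delta * dot w r / 3 <=
    \sum_t p true t * e true t + \sum_t p false t * e false t.
  apply: two_point_average => //.
  - exact: coin_law_sum.
  - exact: coin_law_sum.
  - move=> t; rewrite coin_product card_tuple card_bool.
    have rescale : 2 ^+ 2 * ((1 - delta ^+ 2) / 4) = 1 - delta ^+ 2 by field.
    by rewrite natrX -exprM mulnC exprM -exprMn rescale.
  - by move=> t; exact: excess_ge0.
  - by move=> t; exact: excess_ge0.
  - by rewrite !mulr_ge0 ?dot_ge0//; case/andP: delta01.
  - by move=> t; exact: excess_sum.
have [large|small] := leP (delta * dot w r / 3) (\sum_t p true t * e true t).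
  by exists true; rewrite risk_coin_law lee_fin.
by exists false; rewrite risk_coin_law lee_fin -/(p _) -/(e _); lra.
Qed.

End TwoPointLowerBound.

Lemma minimax_risk_two_point {R : realType} {n : nat} (X : set 'rV[R]_n)
    (gamma : 'rV[R]_n -> R) (k : nat) (w r : 'rV[R]_n) (delta : R) :
  is_norm gamma -> orthosymmetric_norm gamma -> gamma w <= 1 ->
  (forall j, 0 <= w ord0 j) -> (forall j, 0 <= r ord0 j) ->
  (forall b, X (flip (fun=> b) r)) ->
  0 <= delta <= 1 -> 9 / 16 <= (1 - delta ^+ 2) ^+ k ->
  ((delta * dot w r / 3)%:E <= minimax_risk X gamma k)%E.
Proof.
move=> gamma_norm gamma_ortho gamma_w w_ge0 r_ge0 X_center delta01 overlap.
apply: (@le_trans _ _ (minimax_risk_on X gamma k bool)); last first.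
  by apply: ereal_sup_ubound; exists _, bool.
apply: le_ereal_inf_tmp => _ [xhat _ <-].
have [b risk_ge] :=
  two_point_risk X w r delta w_ge0 r_ge0 X_center delta01 k xhat overlap.
apply: (le_trans risk_ge).
apply: le_trans (ereal_sup_ubound _); last first.
  exists (signed_distance w r); last reflexivity.
  exact: signed_distance_fun_class.
apply: ereal_sup_ubound; exists (coin_law delta b) => //.
exact: admissible_coin_law.
Qed.

(** * Choice of the bias and conclusion *)

(** This is ln y <= y - 1 at y = 1/3. *)
Lemma ln3_ge {R : realType} : 2 / 3 <= ln 3 :> R.
Proof.
rewrite [X in ln X](_ : 3 = (1 + - (2 / 3))^-1); last by field.
have pos : 0 < 1 + - (2 / 3) :> R by lra.
by rewrite lnV ?posrE// lerNr le_ln1Dx//; lra.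
Qed.

(** Here k delta^2 = 1 / (4 ln 3) <= 3/8, and 1 - 3/8 >= 9/16. *)
Lemma two_point_bias {R : realType} (k : nat) :
  (1 <= k)%N ->
  let delta : R := (2 * Num.sqrt (k%:R * ln 3))^-1 in
  0 <= delta <= 1 /\ 9 / 16 <= (1 - delta ^+ 2) ^+ k.
Proof.
move=> k_ge1 delta; have ln3 := @ln3_ge R.
have k_ge1' : 1 <= k%:R :> R by rewrite ler1n.
have kln_gt0 : 0 < k%:R * ln 3 :> R by rewrite mulr_gt0; lra.
have delta_ge0 : 0 <= delta by rewrite invr_ge0 mulr_ge0// sqrtr_ge0.
have k_delta2 : k%:R * delta ^+ 2 = (4 * ln 3)^-1.
  rewrite exprVn exprMn sqr_sqrtr ?ltW//; field.
  by apply/andP; split; lra.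
have k_delta2_le : k%:R * delta ^+ 2 <= 3 / 8.
  by rewrite k_delta2 -[leRHS]invrK lef_pV2 ?posrE; lra.
have delta2_le : delta ^+ 2 <= 1.
  have : 0 <= (k%:R - 1) * delta ^+ 2 by rewrite mulr_ge0 ?sqr_ge0// subr_ge0.
  by lra.
split; first by rewrite delta_ge0 -(@expr_le1 _ 2).
have := bernoulli_inequality (delta ^+ 2) k; rewrite sqr_ge0 delta2_le => /(_ isT).
by lra.
Qed.

Theorem corollary8 (R : realType) (n : nat) (X : set 'rV[R]_n)
    (gamma : 'rV[R]_n -> R) (k : nat)
    (X_nonempty : X !=set0)
    (X_orthosymmetric : orthosymmetric_set X)
    (X_convex : convex_set (X : set (convex_lmodType 'rV[R]_n)))
    (gamma_norm : is_norm gamma)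
    (gamma_orthosymmetric : orthosymmetric_norm gamma)
    (k_ge1 : (1 <= k)%N) :
  ((8 * Num.sqrt (k%:R * ln 3))^-1%:E
     * ereal_sup [set dual_norm gamma x | x in X]
   <= minimax_risk X gamma k)%E.
Proof.
have [delta01 overlap] := @two_point_bias R k k_ge1.
set delta := (2 * _)^-1 in delta01 overlap.
have kln_gt0 : 0 < k%:R * ln 3 :> R.
  by rewrite mulr_gt0 ?ltr0n//; have := @ln3_ge R; lra.
have sqrt_gt0 : 0 < Num.sqrt (k%:R * ln 3) :> R by rewrite sqrtr_gt0.
have scale_delta : (8 * Num.sqrt (k%:R * ln 3))^-1 = delta / 4.
  by rewrite /delta; field; rewrite gt_eqF.
rewrite lee_pdivrMl ?mulr_gt0//.
apply: ge_ereal_sup => _ [x Xx <-]; apply: ge_ereal_sup => _ [z gamma_z <-].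
rewrite -lee_pdivrMl ?mulr_gt0// -EFinM scale_delta.
pose signs (v : 'rV[R]_n) (j : 'I_n) := v ord0 j < 0.
have flip_signs v j : flip (signs v) v ord0 j = `|v ord0 j|.
  rewrite mxE /signs; case: ltP => vj.
    by rewrite expr1 mulN1r ltr0_norm.
  by rewrite expr0 mul1r ger0_norm.
pose w := flip (signs z) z; pose r := flip (signs x) x.
have w_ge0 j : 0 <= w ord0 j by rewrite flip_signs.
have r_ge0 j : 0 <= r ord0 j by rewrite flip_signs.
have dot_le : dot z x <= dot w r.
  by apply: ler_sum => j _; rewrite !flip_signs -normrM ler_norm.
apply: le_trans (@minimax_risk_two_point R n X gamma k w r delta _ _ _ _ _ _ _ _) => //.
- rewrite lee_fin; have := @dot_ge0 R n w r w_ge0 r_ge0.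
  case/andP: delta01 => delta_ge0 _ D_ge0.
  have := mulr_ge0 delta_ge0 D_ge0.
  have : 0 <= delta * (dot w r - dot z x) by rewrite mulr_ge0// subr_ge0.
  by lra.
- by rewrite gamma_orthosymmetric.
- by move=> b; exact: (X_orthosymmetric _ _ (X_orthosymmetric _ _ Xx)).
Qed.
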